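(* For all positive real numbers $a,b$ and all $\nu\in[0,1]$, $$S\left(\left(\frac{a}{b}\right)^{r}\right)\left((1-\nu)\frac{1}{a}+\nu\frac{1}{b}\right)^{-1}\;\leq\; a^{1-\nu}b^{\nu},$$ where $r=\min\{\nu,1-\nu\}$ and $S(\cdot)$ is Specht's ratio.
   Context: Specht's ratio is the function $S:(0,\infty)\to\mathbb{R}$ defined by $$S(h)=\frac{h^{\frac{1}{h-1}}}{e\,\log\left(h^{\frac{1}{h-1}}\right)}\quad (h>0,\ h\neq 1),\qquad S(1)=1,$$ where $\log$ is the natural logarithm and $e$ is its base. *)

(* Defs.v *)
From Stdlib Require Import Reals.
Local Open Scope R_scope.

(* Specht's ratio is only meaningful for h > 0; the value for h <= 0 is junk,
   since Rpower h x is exp (x * ln h) with Stdlib's ln totalized there. *)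
Definition specht (h : R) : R :=
  if Req_EM_T h 1 then 1
  else Rpower h (1 / (h - 1)) / (exp 1 * ln (Rpower h (1 / (h - 1)))).

(* Main.v *)
(** Put [L = ln (a / b)].  Multiplying by the weighted arithmetic mean, the claim
    becomes [S (e^(rL)) <= (1-nu) e^(-nu L) + nu e^((1-nu) L)], and [cosh (r L)]
    separates the two sides by convexity of [exp].
    The right-hand side is at least [cosh (r L)] because one of the two points
    [r L], [-r L] coincides with an endpoint and the other lies between
    [-nu L] and [(1-nu) L].
    For the left-hand side, [S (e^u) = (1-l) e^(-l u) + l e^((1-l) u)] with
    [l = 1/u - 1/(e^u - 1)] in [0,1]: this is the mean of [exp] for a centred
    distribution on [[-u, u]], hence at most [cosh u]. *)
Require Import Defs.
From Stdlib Require Import Reals Lra.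
Open Scope R_scope.

(** Averaging the tangent-line bound at the mean [m] over [x] and [y] leaves exactly [exp m], since
    the linear terms cancel. *)
Lemma exp_convex (p x y : R) : 0 <= p <= 1 ->
  exp (p * x + (1 - p) * y) <= p * exp x + (1 - p) * exp y.
Proof.
intros Hp.
set (m := p * x + (1 - p) * y).
assert (tangent : forall z, exp m * (1 + (z - m)) <= exp z).
{ intros z. replace (exp z) with (exp m * exp (z - m)).
  - apply Rmult_le_compat_l; [left; apply exp_pos | apply exp_ineq1_le].
  - rewrite <- exp_plus. f_equal. ring. }
assert (Hx := Rmult_le_compat_l p _ _ (proj1 Hp) (tangent x)).
assert (Hy := Rmult_le_compat_l (1 - p) _ _ ltac:(lra) (tangent y)).
replace (exp m) with
  (p * (exp m * (1 + (x - m))) + (1 - p) * (exp m * (1 + (y - m)))).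
- lra.
- unfold m at 2 4. ring.
Qed.

Lemma exp_mean_le_cosh (l u : R) : 0 <= l <= 1 ->
  (1 - l) * exp (- l * u) + l * exp ((1 - l) * u) <= cosh u.
Proof.
intros Hl.
(* With weights [1 - l] and [l], the points [- l] and [1 - l] have mean 0, so averaging the chord
   bound gives the value of the chord at its midpoint, [cosh u]. *)
assert (chord : forall z, -1 <= z <= 1 ->
  exp (z * u) <= (1 + z) / 2 * exp u + (1 - z) / 2 * exp (- u)).
{ intros z Hz.
  assert (H := exp_convex ((1 + z) / 2) u (- u) ltac:(lra)).
  replace ((1 + z) / 2 * u + (1 - (1 + z) / 2) * - u) with (z * u) in H by field.
  replace (1 - (1 + z) / 2) with ((1 - z) / 2) in H by field.
  exact H. }
assert (H1 := Rmult_le_compat_l (1 - l) _ _ ltac:(lra) (chord (- l) ltac:(lra))).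
assert (H2 := Rmult_le_compat_l l _ _ ltac:(lra) (chord (1 - l) ltac:(lra))).
unfold cosh. lra.
Qed.

Lemma cosh_le_exp_mean (nu L : R) : 0 <= nu <= 1 ->
  cosh (Rmin nu (1 - nu) * L)
    <= (1 - nu) * exp (- nu * L) + nu * exp ((1 - nu) * L).
Proof.
intros Hnu. unfold cosh, Rmin.
destruct (Rle_dec nu (1 - nu)) as [Hle | Hgt].
(* The weight [2 * nu] places [nu * L] between the two endpoints; [- nu * L] is itself an
   endpoint. *)
- assert (H := exp_convex (2 * nu) ((1 - nu) * L) (- nu * L) ltac:(lra)).
  replace (2 * nu * ((1 - nu) * L) + (1 - 2 * nu) * (- nu * L))
    with (nu * L) in H by ring.
  replace (- (nu * L)) with (- nu * L) by ring. lra.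
- assert (H := exp_convex (2 * (1 - nu)) (- nu * L) ((1 - nu) * L) ltac:(lra)).
  replace (2 * (1 - nu) * (- nu * L) + (1 - 2 * (1 - nu)) * ((1 - nu) * L))
    with (- ((1 - nu) * L)) in H by ring.
  lra.
Qed.

(** Over the common denominator [u * (exp u - 1)], which is positive, the two bounds reduce to
    [1 + x <= exp x] at [u] and at [- u]. *)
Lemma inv_sub_inv_exp_bounds (u : R) : u <> 0 ->
  0 <= 1 / u - 1 / (exp u - 1) <= 1.
Proof.
intros Hu.
assert (Hlow := exp_ineq1 u Hu).
assert (Hup : 0 <= 1 - exp u + u * exp u).
{ assert (H := exp_ineq1_le (- u)).
  apply (Rmult_le_compat_l (exp u)) in H; [| left; apply exp_pos].
  rewrite <- exp_plus, Rplus_opp_r, exp_0 in H. lra. }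
assert (Hne : exp u - 1 <> 0) by (destruct (Rtotal_order u 0) as [H|[H|H]];
  [apply exp_increasing in H; rewrite exp_0 in H; lra | lra | lra]).
assert (Hprod : 0 < u * (exp u - 1)).
{ destruct (Rtotal_order u 0) as [H|[H|H]]; [| lra |].
  - assert (E := exp_increasing _ _ H). rewrite exp_0 in E.
    replace (u * (exp u - 1)) with (- u * (1 - exp u)) by ring.
    apply Rmult_lt_0_compat; lra.
  - apply Rmult_lt_0_compat; lra. }
split.
- replace (1 / u - 1 / (exp u - 1)) with ((exp u - 1 - u) / (u * (exp u - 1)))
    by (field; split; assumption).
  apply Rmult_le_pos; [lra | left; apply Rinv_0_lt_compat; exact Hprod].
- assert (0 <= (1 - exp u + u * exp u) / (u * (exp u - 1)))
    by (apply Rmult_le_pos; [lra | left; apply Rinv_0_lt_compat; exact Hprod]).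
  replace (1 / u - 1 / (exp u - 1))
    with (1 - (1 - exp u + u * exp u) / (u * (exp u - 1)))
    by (field; split; assumption).
  lra.
Qed.

(** The choice of [l] makes [u / (exp u - 1) = 1 - l * u], so the factor [exp 1] cancels and both
    sides equal [exp (- l * u) * (exp u - 1) / u]. *)
Lemma specht_exp (u : R) (l := 1 / u - 1 / (exp u - 1)) : u <> 0 ->
  specht (exp u) = (1 - l) * exp (- l * u) + l * exp ((1 - l) * u).
Proof.
intros Hu.
assert (Hne : exp u <> 1) by (rewrite <- exp_0; intros H; apply Hu, exp_inv, H).
assert (Hne' : exp u - 1 <> 0) by lra.
unfold specht. destruct (Req_EM_T (exp u) 1) as [H | _]; [contradiction |].
unfold Rpower. rewrite !ln_exp.
replace (1 / (exp u - 1) * u) with (1 + - l * u) by (unfold l; field; auto).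
replace ((1 - l) * u) with (u + - l * u) by ring.
rewrite !exp_plus.
replace (1 + - l * u) with (u / (exp u - 1)) by (unfold l; field; auto).
set (E := exp (- l * u)).
unfold l. field. repeat split; auto. apply Rgt_not_eq, exp_pos.
Qed.

Lemma specht_exp_le_cosh (u : R) : specht (exp u) <= cosh u.
Proof.
destruct (Req_dec u 0) as [-> | Hu].
- unfold specht. rewrite exp_0, cosh_0.
  destruct (Req_EM_T 1 1); [lra | contradiction].
- rewrite (specht_exp u Hu).
  apply exp_mean_le_cosh, inv_sub_inv_exp_bounds, Hu.
Qed.

Theorem corollary2p6 (a b nu : R) (ha : 0 < a) (hb : 0 < b)
    (hnu : 0 <= nu <= 1) :
  let r := Rmin nu (1 - nu) in
  specht (Rpower (a / b) r) * / ((1 - nu) * (1 / a) + nu * (1 / b))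
    <= Rpower a (1 - nu) * Rpower b nu.
Proof.
intro r.
set (D := (1 - nu) * (1 / a) + nu * (1 / b)).
assert (HD : 0 < D).
{ assert (Ia := Rinv_0_lt_compat a ha). assert (Ib := Rinv_0_lt_compat b hb).
  unfold D, Rdiv. rewrite !Rmult_1_l.
  (* Either weight may vanish, but the larger one is positive. *)
  destruct (Rle_dec nu (1 / 2)).
  - apply Rplus_lt_le_0_compat;
      [apply Rmult_lt_0_compat | apply Rmult_le_pos]; lra.
  - apply Rplus_le_lt_0_compat;
      [apply Rmult_le_pos | apply Rmult_lt_0_compat]; lra. }
apply (Rmult_le_reg_r D); [exact HD |].
rewrite Rmult_assoc, Rinv_l, Rmult_1_r by lra.
unfold Rpower at 1.
apply Rle_trans with (1 := specht_exp_le_cosh _).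
apply Rle_trans with (1 := cosh_le_exp_mean nu (ln (a / b)) hnu).
(* Equality remains: with [L = ln a - ln b], dividing a^(1-nu) b^nu by [a] gives [exp (- nu * L)],
   and by [b] gives [exp ((1 - nu) * L)]. *)
right.
assert (Hln : ln (a / b) = ln a - ln b).
{ unfold Rdiv. rewrite ln_mult, ln_Rinv by auto using Rinv_0_lt_compat. ring. }
assert (Ha : 1 / a = exp (- ln a)) by (rewrite exp_Ropp, exp_ln by auto; field; lra).
assert (Hb : 1 / b = exp (- ln b)) by (rewrite exp_Ropp, exp_ln by auto; field; lra).
unfold D, Rpower. rewrite Ha, Hb, Hln.
rewrite <- exp_plus, Rmult_plus_distr_l.
f_equal.
- replace (- nu * (ln a - ln b))
    with ((1 - nu) * ln a + nu * ln b + - ln a) by ring.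
  rewrite (exp_plus _ (- ln a)). ring.
- replace ((1 - nu) * (ln a - ln b))
    with ((1 - nu) * ln a + nu * ln b + - ln b) by ring.
  rewrite (exp_plus _ (- ln b)). ring.
Qed.
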